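(* The spectrum of nim numbers of avoidance games on edge geometries of trees is $\{0,1,2,3\}$; that is, the set of all values $\mathrm{nim}(\mathrm{DNG}(S,W))$, where $(S,\mathcal{K})$ ranges over the edge geometries of trees and $W$ over nonempty subsets of $S$, equals $\{0,1,2,3\}$.
   Context: The edge geometry of a finite tree $T$ with edge set $S$ is the convex geometry $(S,\mathcal{K})$ where $\mathcal{K}$ consists of the edge sets of connected subgraphs of $T$ (the empty set included). The convex closure operator is $\tau(A)=\bigcap\{K\in\mathcal{K}\mid A\subseteq K\}$ for $A\subseteq S$. Avoidance game $\mathrm{DNG}(S,W)$, for nonempty $W\subseteq S$: two players alternately choose previously unchosen points of $S$, starting from the empty set of chosen points; a player may choose a point only if, with $P$ the set of all jointly chosen points after the move, $W\not\subseteq\tau(P)$. The last player able to move wins. The nim number of a position $P$ is defined recursively by $\mathrm{nim}(P)=\mathrm{mex}\{\mathrm{nim}(Q)\mid Q\in\mathrm{Opt}(P)\}$, where $\mathrm{Opt}(P)$ is the set of positions reachable from $P$ in one legal move and $\mathrm{mex}(A)$ is the smallest nonnegative integer not in $A$; the nim number of the game is that of its starting position $\emptyset$. *)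

(* Defs.v *)
From mathcomp Require Import all_boot.

Set Implicit Arguments.
Unset Strict Implicit.
Unset Printing Implicit Defensive.

Section Mex.

Lemma exists_notin (s : seq nat) : exists n, n \notin s.
Proof.
exists (\max_(i <- s) i).+1; apply/negP => ms.
by have := @leq_bigmax_seq _ s xpredT id _ ms isT; rewrite ltnn.
Qed.

Definition mex (s : seq nat) : nat := ex_minn (exists_notin s).

Lemma mex_eq (s t : seq nat) : s =i t -> mex s = mex t.
Proof.
move=> st; rewrite /mex; case: ex_minnP => m ms mmin; case: ex_minnP => n nt nmin.
by apply/eqP; rewrite eqn_leq mmin ?st // nmin // -st.
Qed.

End Mex.

(* A family K of subsets of S is encoded inside an ambient finite type X.     *)
Section AvoidanceGame.

Variables (X : finType) (S : {set X}) (K : {set {set X}}) (W : {set X}).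

(* In a convex geometry S \in K, so for A \subset S the index set is nonempty *)
(* and the intersection is a subset of S.                                     *)
Definition hull (A : {set X}) : {set X} :=
  \bigcap_(B in K | A \subset B) B.

Definition options (P : {set X}) : {set {set X}} :=
  [set x |: P | x in S :\: P & ~~ (W \subset hull (x |: P))].

Fixpoint nim_rec (k : nat) (P : {set X}) : nat :=
  if k is k'.+1 then mex [seq nim_rec k' Q | Q <- enum (options P)] else 0.

(* The fuel #|S :\: P| bounds the number of remaining moves; [nim_posE] below *)
(* is the defining recursion.                                                 *)
Definition nim_pos (P : {set X}) : nat := nim_rec #|S :\: P| P.

Definition nim_DNG : nat := nim_pos set0.

Lemma card_options (P Q : {set X}) :
  Q \in options P -> #|S :\: Q| < #|S :\: P|.
Proof.
case/imsetP => x; rewrite inE => /andP[xSP _] ->.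
rewrite [ltnRHS](cardsD1 x) xSP add1n ltnS.
by apply: subset_leq_card; apply/subsetP => y; rewrite !inE negb_or -andbA.
Qed.

Lemma nim_rec_fuel (k : nat) (P : {set X}) :
  #|S :\: P| <= k -> nim_rec k P = nim_pos P.
Proof.
suff fuel m l : forall P, #|S :\: P| <= m -> #|S :\: P| <= l ->
    nim_rec m P = nim_rec l P by move=> kP; apply: fuel.
have mex0 : mex [::] = 0 by rewrite /mex; case: ex_minnP => n _ /(_ 0 isT); case: n.
have no_opt R : #|S :\: R| <= 0 -> enum (options R) = [::].
  move=> R0; have -> : options R = set0; last by rewrite enum_set0.
  apply/setP => Q; rewrite inE; apply/negP => /card_options.
  by rewrite ltnNge (leq_trans R0).
elim: m l => [|m IHm] [|l] R //=.
- by move=> /no_opt ->.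
- by move=> _ /no_opt ->.
move=> Rm Rl; congr mex; apply/eq_in_map => Q.
rewrite mem_enum => /card_options RQ.
by apply: IHm; rewrite -ltnS; apply: leq_trans RQ _.
Qed.

Lemma nim_posE (P : {set X}) :
  nim_pos P = mex [seq nim_pos Q | Q <- enum (options P)].
Proof.
rewrite -(nim_rec_fuel (leqnSn _)) /=; congr mex; apply/eq_in_map => Q.
by rewrite mem_enum => /card_options/ltnW; apply: nim_rec_fuel.
Qed.

End AvoidanceGame.

Section EdgeGeometry.

Variables (V : finType) (e : rel V).

Definition is_tree : Prop :=
  [/\ 0 < #|V|, symmetric e, irreflexive e,
      forall x y : V, connect e x y
    & forall c : seq V, 2 < size c -> ~ ucycle e c].

Definition edges : {set {set V}} := [set [set p.1; p.2] | p : V * V & e p.1 p.2].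

(* The pair of a vertex set U and an edge set F is a connected subgraph; the  *)
(* edges of F have both ends in U, so the paths below do not leave U.         *)
Definition connected_subgraph (U : {set V}) (F : {set {set V}}) : bool :=
  [&& F \subset edges, [forall f in F, f \subset U]
    & [forall x in U, forall y in U, connect [rel u v | [set u; v] \in F] x y]].

Definition edge_convex : {set {set {set V}}} :=
  [set F | [exists U, connected_subgraph U F]].

End EdgeGeometry.

Lemma edge_convex0 (V : finType) (e : rel V) : set0 \in edge_convex e.
Proof.
rewrite inE; apply/existsP; exists set0; rewrite /connected_subgraph sub0set /=.
by apply/andP; split; apply/forall_inP => x; rewrite inE.
Qed.

Lemma edge_convexT (V : finType) (e : rel V) :
  is_tree e -> edges e \in edge_convex e.
Proof.
case=> _ _ _ conn _; rewrite inE; apply/existsP; exists setT.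
rewrite /connected_subgraph subxx /=; apply/andP; split.
  by apply/forall_inP => f _; apply: subsetT.
apply/forall_inP => x _; apply/forall_inP => y _.
apply: (@connect_sub _ e) (conn x y) => u v uv; apply: connect1 => /=.
by apply/imsetP; exists (u, v) => //; rewrite inE.
Qed.

Definition tree_DNG_spectrum (n : nat) : Prop :=
  exists (V : finType) (e : rel V) (W : {set {set V}}),
    [/\ is_tree e, W != set0, W \subset edges e
      & nim_DNG (edges e) (edge_convex e) W = n].

(* Main.v *)
Require Import Defs.
From mathcomp Require Import all_boot zify.

Set Implicit Arguments.
Unset Strict Implicit.
Unset Printing Implicit Defensive.

(** Nim numbers never exceed 3 because every such game is a race between
    disjoint blocks.

    Removing an edge [f] of a tree leaves two halves, and a convex set that
    misses [f] lies in one of them, so a position avoids [W] exactly when it lies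
    in a half of some [w] in [W]. If [f] and [g] are distinct edges, the half of
    [f] away from [g], even with [f] added, lies in one half of [g]
    ([far_half]). Hence, when [W] has two edges or more, only the halves of [w]
    that contain the rest of [W] matter, and their complements are pairwise
    disjoint ([trivIset_extreme_blocks]): a position is legal exactly when it
    misses one of these blocks ([avoid_extreme]). When [W] is a single edge [w],
    the blocks are the two halves of [w] in the game on the other edges or, if
    one half is empty, the only block is [[set w]].

    In a block game only three numbers matter: the numbers [a] and [b] of blocks
    of even and of odd size that are still missed, and the number [t] of points
    not yet chosen. If only one missed block remains, of size [c], the rest of
    the play has exactly [t - c] moves, so its nim number is the parity of
    [t - c]. In general the two parities compete: the even blocks win if they are
    more numerous, the odd blocks if they are, and only a tie [a = b] produces 2
    or 3. This is the formula [block_nim], proved by induction in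
    [block_game_nim].

    All four values occur on paths with [m] edges, for [W] made of the first edge
    and one other edge: the two blocks have sizes 1 and [m - j], so that the
    parities of [m - j] and [m] can be chosen freely ([path_end_nim]). *)

(** * Mex and hulls *)

Lemma mexP (s : seq nat) (m : nat) :
  m \notin s -> (forall k, k < m -> k \in s) -> mex s = m.
Proof.
move=> ms ltm; rewrite /mex; case: ex_minnP => k ks kmin.
apply/eqP; rewrite eqn_leq kmin //= leqNgt; apply/negP => /ltm.
by rewrite (negPf ks).
Qed.

Section Hull.

Variables (X : finType) (K : {set {set X}}).

Lemma notin_hullP (P : {set X}) (x : X) :
  reflect (exists2 F, F \in K & (P \subset F) && (x \notin F))
          (x \notin hull K P).
Proof.
apply: (iffP idP) => [xP|[F FK /andP[PF xF]]]; last first.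
  by apply: contra xF => /bigcapP; apply; rewrite FK.
case: (pickP [pred F in K | (P \subset F) && (x \notin F)]) => [F|none].
  by case/andP=> FK PF; exists F.
case/negP: xP; apply/bigcapP => F /andP[FK PF]; apply/negPn/negP => xF.
by have := none F; rewrite inE FK PF xF.
Qed.

End Hull.

(** * Blocks counted by the parity of their size *)

Section Blocks.

Variable X : finType.
Implicit Types (M : {set {set X}}) (B : {set X}).

Definition even_blocks M : nat := #|[set B in M | ~~ odd #|B| ]|.
Definition odd_blocks M : nat := #|[set B in M | odd #|B| ]|.

Lemma even_blocksD1 M B : B \in M ->
  even_blocks M = ~~ odd #|B| + even_blocks (M :\ B).
Proof.
move=> BM; rewrite /even_blocks (cardsD1 B) inE BM /=; congr (_ + _).
by apply: eq_card => A; rewrite !inE andbA.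
Qed.

Lemma odd_blocksD1 M B : B \in M ->
  odd_blocks M = odd #|B| + odd_blocks (M :\ B).
Proof.
move=> BM; rewrite /odd_blocks (cardsD1 B) inE BM /=; congr (_ + _).
by apply: eq_card => A; rewrite !inE andbA.
Qed.

Lemma card_blocks M : #|M| = even_blocks M + odd_blocks M.
Proof.
rewrite /even_blocks /odd_blocks -(cardsID [set B : {set X} | odd #|B|] M) addnC.
by congr (_ + _); apply: eq_card => B; rewrite !inE // andbC.
Qed.

Lemma odd_card_cover M : trivIset M -> odd #|cover M| = odd (odd_blocks M).
Proof.
move/eqP <-; rewrite /odd_blocks -sum1_card !(big_morph odd oddD (erefl _)).
rewrite [RHS](eq_bigl (fun B => (B \in M) && odd #|B|)); last by move=> B; rewrite inE.
by rewrite [RHS]big_mkcondr; apply: eq_bigr => B _; case: odd.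
Qed.

End Blocks.

Lemma even_blocks2 (X : finType) (A B : {set X}) : A != B ->
  even_blocks [set A; B] = ~~ odd #|A| + ~~ odd #|B|.
Proof.
move=> AB; rewrite (even_blocksD1 (set21 A B)) setU1K ?in_set1 //.
rewrite (even_blocksD1 (set11 B)) setDv /even_blocks.
by rewrite (eq_card0 (A := [set _ in set0 | _])) ?addn0 // => C; rewrite !inE.
Qed.

Lemma odd_blocks2 (X : finType) (A B : {set X}) : A != B ->
  odd_blocks [set A; B] = odd #|A| + odd #|B|.
Proof.
move=> AB; rewrite (odd_blocksD1 (set21 A B)) setU1K ?in_set1 //.
rewrite (odd_blocksD1 (set11 B)) setDv /odd_blocks.
by rewrite (eq_card0 (A := [set _ in set0 | _])) ?addn0 // => C; rewrite !inE.
Qed.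

(** * The arithmetic of block games *)

(** A majority of even blocks gives the parity of [t], a majority of odd blocks
    the opposite parity, as if a block of the majority were the one missed at
    the end of the play. *)
Definition block_nim (a b t : nat) : nat :=
  if a == b then 2 + odd (a + t) else odd t (+) (a < b).

Ltac block_nim_arith t :=
  repeat match goal with H : context [_ \in _] |- _ => clear H end;
  destruct t as [|t] => //=; case: ifP; lia.

Lemma block_nim_le3 a b t : block_nim a b t <= 3.
Proof. by rewrite /block_nim; case: ifP => _; lia. Qed.

(** A move leaves the missed blocks alone, or hits an even one, or hits an odd
    one, and each flips the parity of [t]. The last two need another missed
    block for the move to be legal. A free move is only promised when the
    parities of [t] and [b] differ; elsewhere the required option comes from
    hitting a block. *)
Lemma mex_block_nim a b t s : 0 < a + b ->
  (odd t != odd b -> 0 < t /\ block_nim a b t.-1 \in s) ->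
  (0 < a -> 1 < a + b -> 0 < t /\ block_nim a.-1 b t.-1 \in s) ->
  (0 < b -> 1 < a + b -> 0 < t /\ block_nim a b.-1 t.-1 \in s) ->
  (forall v, v \in s -> 0 < t /\ [\/ v = block_nim a b t.-1,
     0 < a /\ v = block_nim a.-1 b t.-1 | 0 < b /\ v = block_nim a b.-1 t.-1]) ->
  mex s = block_nim a b t.
Proof.
move=> ab0 free_opt even_opt odd_opt all_opt; apply: mexP.
  apply/negP => /all_opt[]; case: t {free_opt even_opt odd_opt all_opt} => //= t _.
  rewrite /block_nim; case=> [|[]|[]];
  do !case: ifP; lia.
(* From here on, each value below [block_nim a b t] is reached by some move. *)
have opt k u : 0 < t /\ u \in s -> (0 < t -> u = k) -> k \in s.
  by case=> t0 us /(_ t0) <-.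
move=> k; rewrite /block_nim; have [ab|ab|ab] := ltngtP a b => /= kt.
(* The odd blocks lead: the move must leave them in the lead, so it hits an odd
   block if the lead is at least 2, otherwise an even block, and it is free if
   a single odd block remains. *)
- have [b2|b2] := ltnP a.+1 b.
    apply: opt (odd_opt _ _) _; rewrite /block_nim; [lia|lia|].
    by block_nim_arith t.
  have [a0|a0] := posnP a.
    apply: opt (free_opt _) _; rewrite /block_nim; first by lia.
    by block_nim_arith t.
  apply: opt (even_opt _ _) _; rewrite /block_nim; [lia|lia|].
  by block_nim_arith t.
(* The even blocks lead: hitting an odd block keeps the lead, and so does a
   free move when no odd block remains. *)
- have [b0|b0] := posnP b.
    apply: opt (free_opt _) _; rewrite /block_nim; first by lia.
    by block_nim_arith t.
  apply: opt (odd_opt _ _) _; rewrite /block_nim; [lia|lia|].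
  by block_nim_arith t.
(* A tie: hitting a block of either parity breaks it and yields both 0 and 1;
   the option 2 that the value 3 requires is another tie, left by a free move. *)
- have [k2|k2] := eqVneq k 2.
    apply: opt (free_opt _) _; rewrite /block_nim; first by lia.
    by block_nim_arith t.
  have [kE|kE] := eqVneq k (odd t).
    apply: opt (even_opt _ _) _; rewrite /block_nim; [lia|lia|].
    by block_nim_arith t.
  apply: opt (odd_opt _ _) _; rewrite /block_nim; [lia|lia|].
  by block_nim_arith t.
Qed.

(** * Games of avoiding one of several disjoint blocks *)

Lemma disjoint0s (T : finType) (B : {set T}) : [disjoint set0 & B].
Proof. by rewrite -setI_eq0 set0I. Qed.

Lemma disjointsU1 (X : finType) (x : X) (A B : {set X}) :
  [disjoint x |: A & B] = (x \notin B) && [disjoint A & B].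
Proof. by rewrite -!setI_eq0 setIUl setU_eq0 setI_eq0 disjoints1. Qed.

Section BlockGame.

Variables (X : finType) (S : {set X}) (K : {set {set X}}) (W : {set X}).
Variables (D : {set X}) (C : {set {set X}}).

Hypothesis DS : D \subset S.
Hypothesis CD : cover C \subset D.
Hypothesis trivC : trivIset C.
Hypothesis neC : set0 \notin C.
Hypothesis legalE : forall P : {set X}, P \subset S ->
  ~~ (W \subset hull K P) = (P \subset D) && [exists B in C, [disjoint P & B]].

Let missed (P : {set X}) := [set B in C | [disjoint P & B]].

Let missed_block (P B : {set X}) x : B \in missed P -> x \in B ->
  missed (x |: P) = missed P :\ B.
Proof.
rewrite inE => /andP[BC PB] xB; apply/setP => A; rewrite !inE disjointsU1.
have [AC|] := boolP (A \in C); rewrite ?andbF //=.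
case: eqP => [-> | /eqP AB] /=; first by rewrite xB.
suff -> : x \notin A by [].
have /trivIsetP/(_ A B AC BC AB) := trivC.
by rewrite disjoint_sym => /disjointFr ->.
Qed.

Let missed_free (P : {set X}) x : x \notin cover (missed P) ->
  missed (x |: P) = missed P.
Proof.
move=> xM; apply/setP => A; rewrite !inE disjointsU1.
have [AC|] //= := boolP (A \in C).
have [PA|] := boolP [disjoint P & A]; last by rewrite andbF.
rewrite andbT; apply: contra xM => xA; apply/bigcupP; exists A => //.
by rewrite inE AC.
Qed.

(** If all unchosen points lay in missed blocks, they would fill these blocks
    exactly, and their number would have the parity of the number of odd ones. *)
Let free_move (P : {set X}) : P \subset D ->
  odd #|D :\: P| != odd (odd_blocks (missed P)) ->
  exists2 x, x \in D :\: P & x \notin cover (missed P).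
Proof.
move=> PD; case: (pickP [pred x in D :\: P | x \notin cover (missed P)]).
  by move=> x /andP[xDP xM] _; exists x.
move=> none /eqP[]; rewrite -odd_card_cover; last first.
  by apply: trivIsetS trivC; apply/subsetP => B; rewrite inE => /andP[].
congr (odd _); apply/eq_card => x; apply/idP/idP => [xDP|].
  by apply/negPn/negP => xM; have := none x; rewrite inE xDP xM.
case/bigcupP => B; rewrite inE => /andP[BC PB] xB; rewrite inE (disjointFl PB xB).
by apply: (subsetP CD); apply/bigcupP; exists B.
Qed.

Let block_move (P B : {set X}) : B \in missed P -> exists2 x, x \in D :\: P & x \in B.
Proof.
rewrite inE => /andP[BC PB].
have /set0Pn[x xB] : B != set0 by apply: contra neC => /eqP <-.
exists x => //; rewrite inE (disjointFl PB xB).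
by apply: (subsetP CD); apply/bigcupP; exists B.
Qed.

(** Induction on the number of unchosen points. [D] is the set of points that
    can ever be played: it is all of [S] except when [W] is a single edge. *)
Theorem block_game_nim (P : {set X}) : P \subset D -> missed P != set0 ->
  nim_pos S K W P =
  block_nim (even_blocks (missed P)) (odd_blocks (missed P)) #|D :\: P|.
Proof.
have [m] := ubnP #|D :\: P|; elim: m P => // m IHm P ltm PD neM.
set M := missed P in neM *; set t := #|D :\: P| in ltm *.
set a := even_blocks M; set b := odd_blocks M.
have abM : #|M| = a + b by apply: card_blocks.
have optP x : x \in D :\: P -> missed (x |: P) != set0 ->
    nim_pos S K W (x |: P) = block_nim (even_blocks (missed (x |: P)))
                             (odd_blocks (missed (x |: P))) t.-1
    /\ 0 < t.
  move=> xDP ne; have tE : t = #|D :\: (x |: P)|.+1.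
    rewrite /t (cardsD1 x) xDP add1n; congr _.+1; apply: eq_card => y.
    by rewrite !inE negb_or -andbA.
  rewrite tE; split=> //=; apply: IHm => //; first by rewrite -tE in ltm *; lia.
  by rewrite subUset sub1set PD andbT; case/setDP: xDP.
have legal x : x \in D :\: P -> missed (x |: P) != set0 ->
    nim_pos S K W (x |: P) \in [seq nim_pos S K W Q | Q <- enum (options S K W P)].
  move=> /setDP[xD xP] /set0Pn[B]; rewrite inE => /andP[BC PB].
  apply: map_f; rewrite mem_enum; apply: imset_f.
  have xPD : x |: P \subset D by rewrite subUset sub1set xD.
  rewrite !inE xP (subsetP DS) //= legalE ?xPD /=; last exact: subset_trans DS.
  by apply/exists_inP; exists B.
have free_opt : odd t != odd b -> 0 < t /\ block_nim a b t.-1 \in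
    [seq nim_pos S K W Q | Q <- enum (options S K W P)].
  case/(free_move PD) => x xDP xM; have ME := missed_free xM.
  have neMx : missed (x |: P) != set0 by rewrite ME.
  have [nx t0] := optP x xDP neMx; split=> //.
  by have := legal x xDP neMx; rewrite nx ME.
have block_opt B : B \in M -> 1 < a + b ->
    0 < t /\ block_nim (a - ~~ odd #|B|) (b - odd #|B|) t.-1 \in
    [seq nim_pos S K W Q | Q <- enum (options S K W P)].
  move=> BM ab1; have [x xDP xB] := block_move BM; have ME := missed_block BM xB.
  have neMx : missed (x |: P) != set0.
    by rewrite -card_gt0 ME; move: ab1; rewrite -abM (cardsD1 B M) BM.
  have [nx t0] := optP x xDP neMx; split=> //.
  have := legal x xDP neMx; rewrite nx ME.
  by rewrite /a /b (even_blocksD1 BM) (odd_blocksD1 BM) !addKn.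
have even_opt : 0 < a -> 1 < a + b -> 0 < t /\ block_nim a.-1 b t.-1 \in
    [seq nim_pos S K W Q | Q <- enum (options S K W P)].
  rewrite /a /even_blocks card_gt0 => /set0Pn[B]; rewrite inE => /andP[BM oB].
  by move=> /(block_opt B BM); rewrite (negPf oB) subn1 subn0.
have odd_opt : 0 < b -> 1 < a + b -> 0 < t /\ block_nim a b.-1 t.-1 \in
    [seq nim_pos S K W Q | Q <- enum (options S K W P)].
  rewrite /b /odd_blocks card_gt0 => /set0Pn[B]; rewrite inE => /andP[BM oB].
  by move=> /(block_opt B BM); rewrite oB subn1 subn0.
have all_opt v : v \in [seq nim_pos S K W Q | Q <- enum (options S K W P)] ->
    0 < t /\ [\/ v = block_nim a b t.-1, 0 < a /\ v = block_nim a.-1 b t.-1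
             | 0 < b /\ v = block_nim a b.-1 t.-1].
  case/mapP => Q; rewrite mem_enum => /imsetP[x]; rewrite inE => /andP[xSP].
  have [xS xP] := setDP xSP => lx -> ->.
  have xPS : x |: P \subset S.
    by rewrite subUset sub1set xS; apply: subset_trans DS.
  move: lx; rewrite legalE // subUset sub1set => /andP[/andP[xD _]] /exists_inP[B BC PB].
  have xDP : x \in D :\: P by rewrite inE xP.
  have neMx : missed (x |: P) != set0 by apply/set0Pn; exists B; rewrite inE BC.
  have [-> t0] := optP x xDP neMx; split=> //.
  have [/bigcupP[A AM xA]|xM] := boolP (x \in cover M); last first.
    by constructor 1; rewrite missed_free.
  rewrite (missed_block AM xA) /a /b (even_blocksD1 AM) (odd_blocksD1 AM).
  by case: (odd #|A|); [constructor 3 | constructor 2]; rewrite ?add0n.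
have ab0 : 0 < a + b by rewrite -abM card_gt0.
by rewrite nim_posE; apply: mex_block_nim.
Qed.

End BlockGame.

Corollary block_game_start (X : finType) (S : {set X}) (K : {set {set X}})
  (W D : {set X}) (C : {set {set X}}) :
  D \subset S -> cover C \subset D -> trivIset C -> set0 \notin C ->
  (forall P : {set X}, P \subset S ->
     ~~ (W \subset hull K P) = (P \subset D) && [exists B in C, [disjoint P & B]]) ->
  C != set0 ->
  nim_DNG S K W = block_nim (even_blocks C) (odd_blocks C) #|D|.
Proof.
move=> DS CD tC nC legal C0.
have missed0 : [set B in C | [disjoint set0 & B]] = C.
  by apply/setP => B; rewrite inE disjoint0s andbT.
by rewrite /nim_DNG (block_game_nim DS CD tC nC legal) ?sub0set ?missed0 ?setD0.
Qed.

(** * The two halves of a tree cut at an edge *)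

Lemma connectS (V : finType) (r : rel V) (A : pred V) x y :
  A x -> (forall u v, A u -> r u v -> A v) -> connect r x y -> A y.
Proof.
move=> Ax step /connectP[p]; elim: p x Ax => [x Ax _ -> //|z p IHp x Ax /= /andP[xz]].
exact: IHp (step _ _ Ax xz).
Qed.

Lemma edgesP {V : finType} {e : rel V} (f : {set V}) :
  reflect (exists x y, e x y /\ f = [set x; y]) (f \in edges e).
Proof.
apply: (iffP imsetP) => [[[x y]]|[x [y [xy ->]]]].
  by rewrite inE /= => xy ->; exists x, y.
by exists (x, y); rewrite ?inE.
Qed.

Lemma edge_rel (V : finType) (e : rel V) a b : symmetric e -> irreflexive e ->
  [set a; b] \in edges e -> e a b.
Proof.
move=> sym irr /edgesP[c [d [cd E]]].
have /set2P[ac|ad] : a \in [set c; d] by rewrite -E set21.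
  have /set2P[dA|db] : d \in [set a; b] by rewrite E set22.
    by rewrite dA ac irr in cd.
  by rewrite ac -db.
have /set2P[cA|cb] : c \in [set a; b] by rewrite E set21.
  by rewrite cA ad irr in cd.
by rewrite ad -cb sym.
Qed.

Section TreeHalves.

Variables (V : finType) (e : rel V).
Hypothesis treeE : is_tree e.

Let S := edges e.
Let K := edge_convex e.

Definition cut (f : {set V}) : rel V := [rel u v | e u v && ([set u; v] != f)].

(** The half of [f] at its end [x]. An edge with its two ends in the component
    of [x] is automatically distinct from [f], since [f] joins two components. *)
Definition half (f : {set V}) (x : V) : {set {set V}} :=
  [set g in edges e | g \subset [set v | connect (cut f) x v]].

Lemma cut_connectC f : connect_sym (cut f).
Proof.
case: treeE => _ sym _ _ _; apply: sym_connect_sym => u v /=.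
by rewrite /cut /= sym setUC.
Qed.

(** A path from [x] to [y] that avoids the edge would close up with it to a
    cycle. *)
Lemma cut_disconnects x y : e x y -> ~~ connect (cut [set x; y]) x y.
Proof.
case: treeE => _ sym irr _ acyc xy; apply/negP => /connectP[p0].
case/shortenP=> p px up _ lp; apply: (acyc (x :: p)).
  case: p px lp {up} => [_ yx|z [|//] /= /andP[xz _] lp].
    by rewrite yx /= irr in xy.
  by rewrite lp /cut /= eqxx andbF in xz.
rewrite /ucycle up andbT /= rcons_path -lp sym xy andbT.
by apply: sub_path px => u v /andP[].
Qed.

Lemma cut_covers x y v : e x y ->
  connect (cut [set x; y]) x v || connect (cut [set x; y]) y v.
Proof.
case: treeE => _ sym irr conn _ xy; set f := [set x; y].
apply: (connectS (A := fun v => connect (cut f) x v || connect (cut f) y v)) (conn x v).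
  by rewrite connect0.
move=> u w /=; have [uwf|uwf] := eqVneq [set u; w] f.
  move=> _ _; have : w \in f by rewrite -uwf set22.
  by case/set2P=> ->; rewrite connect0 ?orbT.
move=> uX uw; have cuw : connect (cut f) u w by apply: connect1; rewrite /cut /= uw uwf.
by case/orP: uX => /connect_trans/(_ cuw) ->; rewrite ?orbT.
Qed.

Lemma half_sub f x : half f x \subset S.
Proof. by apply/subsetP => g; rewrite inE => /andP[]. Qed.

Lemma edge_in_half f x u v : e u v -> [set u; v] != f -> connect (cut f) x u ->
  [set u; v] \in half f x.
Proof.
move=> uv uvf xu; rewrite inE; apply/andP; split; first by apply/edgesP; exists u, v.
apply/subsetP => w /set2P[]->; rewrite inE //.
by apply: connect_trans xu (connect1 _); rewrite /cut /= uv.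
Qed.

Lemma edge_ends f x y : f \in S -> x \in f -> y \in f -> x != y -> f = [set x; y] /\ e x y.
Proof.
case: treeE => _ sym _ _ _.
case/edgesP => u [v [uv ->]] /set2P[]-> /set2P[]->; rewrite ?eqxx //.
by rewrite setUC sym.
Qed.

Lemma edge_notin_half f x : f \in S -> x \in f -> f \notin half f x.
Proof.
case: treeE => _ sym _ _ _.
move=> fS xf; apply/negP; rewrite inE => /andP[_ fx].
have [a [b [ab fE]]] := edgesP _ fS.
have := cut_disconnects ab; rewrite -fE => /negP[].
move/subsetP: fx => fx; apply: (@connect_trans _ _ x); last first.
  by have := fx b; rewrite inE; apply; rewrite fE set22.
by rewrite cut_connectC; have := fx a; rewrite inE; apply; rewrite fE set21.
Qed.

Lemma half_disjoint f x y : f \in S -> x \in f -> y \in f -> x != y ->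
  [disjoint half f x & half f y].
Proof.
move=> fS xf yf xy; have [fE exy] := edge_ends fS xf yf xy.
apply/pred0P => g /=; apply/negP => /andP[]; rewrite !inE => /andP[/edgesP[u [v [_ ->]]]].
rewrite !subUset !sub1set !inE => /andP[xu _] /and3P[_ yu _].
case/negP: (cut_disconnects exy); rewrite -fE.
by apply: connect_trans xu _; rewrite cut_connectC.
Qed.

Lemma half_cover f g : f \in S -> g \in S -> g != f ->
  exists2 x, x \in f & g \in half f x.
Proof.
case/edgesP=> x [y [xy ->]] /edgesP[u [v [uv ->]]] gf.
case/orP: (cut_covers u xy) => cu; [exists x|exists y]; rewrite ?set21 ?set22 //;
exact: edge_in_half.
Qed.

(** Since the edges of a subgraph are symmetric, reaching every vertex from one
    root is enough for connectedness. *)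
Lemma rooted_convex (U : {set V}) (F : {set {set V}}) (x : V) : F \subset S ->
  (forall f, f \in F -> f \subset U) ->
  (forall v, v \in U -> connect [rel u w | [set u; w] \in F] x v) -> F \in K.
Proof.
move=> FS FU conn; rewrite inE; apply/existsP; exists U; apply/and3P; split=> //.
  exact/forall_inP.
apply/forall_inP => u uU; apply/forall_inP => v vU.
apply: connect_trans (conn v vU); rewrite sym_connect_sym ?conn // => a b /=.
by rewrite setUC.
Qed.

Lemma half_connect f x v (F : {set {set V}}) : half f x \subset F ->
  connect (cut f) x v -> connect [rel u w | [set u; w] \in F] x v.
Proof.
move=> hF cv; pose A v := connect (cut f) x v && connect [rel u w | [set u; w] \in F] x v.
suff /andP[] : A v by [].
apply: (connectS (A := A)) cv; first by rewrite /A !connect0.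
move=> u w /andP[xu xuF] uw; have /andP[euw uwf] := uw.
rewrite /A (connect_trans xu (connect1 uw)) /=; apply: connect_trans xuF (connect1 _).
by apply: (subsetP hF); apply: edge_in_half.
Qed.

Lemma half_convex f x : half f x \in K.
Proof.
apply: (@rooted_convex [set v | connect (cut f) x v] _ x); first exact: half_sub.
  by move=> g; rewrite inE => /andP[].
by move=> v; rewrite inE; apply: half_connect.
Qed.

Lemma half_edge_convex f x : f \in S -> x \in f -> f |: half f x \in K.
Proof.
move=> fS xf; have [a [b [ab fE]]] := edgesP _ fS.
apply: (@rooted_convex (f :|: [set v | connect (cut f) x v]) _ x).
- by rewrite subUset sub1set fS half_sub.
- move=> g /setU1P[->|]; first exact: subsetUl.
  by rewrite inE => /andP[_ gx]; apply: subset_trans gx (subsetUr _ _).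
move=> v; rewrite 2!inE => /orP[vf|]; last by apply: half_connect; apply: subsetUr.
have [->|xv] := eqVneq x v; first exact: connect0.
by apply: connect1; rewrite /= -(edge_ends fS xf vf xv).1 setU11.
Qed.

(** Paths inside a subgraph that misses [f] survive the removal of [f], so they
    cannot pass from one half to the other. *)
Lemma convex_in_half f F : f \in S -> F \in K -> f \notin F ->
  exists2 x, x \in f & F \subset half f x.
Proof.
move=> fS; rewrite inE => /existsP[U /and3P[FS /forall_inP FU /forall_inP conn]] fF.
have [->|[g gF]] := set_0Vmem F.
  have [a [b [_ ->]]] := edgesP _ fS; exists a; rewrite ?set21 ?sub0set //.
have gf : g != f by apply: contraNneq fF => <-.
have [x xf gx] := half_cover fS (subsetP FS g gF) gf; exists x => //.
apply/subsetP => h hF; rewrite inE (subsetP FS) //=.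
apply/subsetP => v vh; rewrite inE.
have [u [w [_ gE]]] := edgesP _ (subsetP FS g gF).
have ug : u \in g by rewrite gE set21.
have xu : connect (cut f) x u.
  by move: gx; rewrite inE => /andP[_ /subsetP/(_ u ug)]; rewrite inE.
apply: connect_trans xu _.
have uU := subsetP (FU g gF) u ug; have vU := subsetP (FU h hF) v vh.
apply: connect_sub (forall_inP (conn u uU) v vU) => a b /= abF; apply: connect1.
case: treeE => _ sym irr _ _; rewrite /cut /= (edge_rel sym irr (subsetP FS _ abF)) /=.
by apply: contraNneq fF => <-.
Qed.

Lemma notin_hull_half f (P : {set {set V}}) : f \in S ->
  reflect (exists2 x, x \in f & P \subset half f x) (f \notin hull K P).
Proof.
move=> fS; apply: (iffP (notin_hullP _ _ _)) => [[F FK /andP[PF fF]]|[x xf Px]].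
  by have [x xf Fx] := convex_in_half fS FK fF; exists x => //; apply: subset_trans Fx.
by exists (half f x); rewrite ?half_convex // Px edge_notin_half.
Qed.

(** The nesting of halves: adding [f] to its half keeps it convex, and the result
    still misses [g]. *)
Lemma far_half f g x : f \in S -> g \in S -> f != g -> x \in f -> g \notin half f x ->
  exists2 y, y \in g & f |: half f x \subset half g y.
Proof.
move=> fS gS fg xf gx; apply: convex_in_half gS (half_edge_convex fS xf) _.
by rewrite in_setU1 negb_or eq_sym fg.
Qed.

Lemma half_compl f x y : f \in S -> x \in f -> y \in f -> x != y ->
  forall g, (g \in half f y) = [&& g \in S, g != f & g \notin half f x].
Proof.
move=> fS xf yf xy g; apply/idP/and3P => [gy|[gS gf gx]].
  split; first exact: (subsetP (half_sub f y)).
    by apply: contraTneq gy => ->; apply: edge_notin_half.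
  by rewrite (disjointFl (half_disjoint fS xf yf xy) gy).
have [z zf gz] := half_cover fS gS gf.
have [fE _] := edge_ends fS xf yf xy.
by move: zf gz gx; rewrite {1}fE => /set2P[]-> // ->.
Qed.

(** * Avoidance games on trees as block games *)

Section Avoidance.

Variable W : {set {set V}}.
Hypothesis WS : W \subset S.

Lemma avoidP (P : {set {set V}}) :
  reflect (exists w x, [/\ w \in W, x \in w & P \subset half w x])
          (~~ (W \subset hull K P)).
Proof.
apply: (iffP subsetPn) => [[w wW /(notin_hull_half _ (subsetP WS w wW))[x xw Px]]|].
  by exists w, x.
case=> w [x [wW xw Px]]; exists w => //.
by apply/notin_hull_half; [apply: (subsetP WS) | exists x].
Qed.

(** The edges [w] used here are the extreme points of the hull of [W]: those
    outside the hull of the rest of [W]. The block of [w] consists of [w] and of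
    everything behind it. *)
Definition extreme_blocks : {set {set {set V}}} :=
  [set edges e :\: half p.1 p.2 | p : {set V} * V
     & [&& p.1 \in W, p.2 \in p.1 & W :\ p.1 \subset half p.1 p.2]].

Lemma extreme_blocksP B :
  reflect (exists w x, [/\ w \in W, x \in w, W :\ w \subset half w x
                        & B = S :\: half w x])
          (B \in extreme_blocks).
Proof.
apply: (iffP imsetP) => [[[w x]]|[w [x [wW xw Wx ->]]]].
  by rewrite inE /= => /and3P[wW xw Wx] ->; exists w, x.
by exists (w, x) => //; rewrite inE /= wW xw.
Qed.

Lemma set0_extreme_blocks : set0 \notin extreme_blocks.
Proof.
apply/extreme_blocksP => -[w [x [wW xw _ /esym/setP/(_ w)]]].
by rewrite in_setD in_set0 (subsetP WS w wW) edge_notin_half // (subsetP WS).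
Qed.

Hypothesis W2 : 1 < #|W|.

(** An edge [g] in the blocks of both [w] and [w'] would lie in the half of [w]
    away from [w'], hence, by nesting, in the half of [w'] that contains [w];
    but that half is the complement of the block of [w']. *)
Lemma trivIset_extreme_blocks : trivIset extreme_blocks.
Proof.
apply/trivIsetP => A B /extreme_blocksP[w [x [wW xw Wx ->]]].
case/extreme_blocksP=> w' [x' [w'W x'w Wx' ->]] AB.
have wS := subsetP WS w wW; have w'S := subsetP WS w' w'W.
apply/pred0P => g /=; apply/negP => /andP[/setDP[gS gx] /setDP[_ gx']].
have [ww|ww] := eqVneq w w'.
  subst w'; have xx : x != x' by apply: contraNneq AB => ->.
  have /card_gt0P[h hW] : 0 < #|W :\ w| by move: W2; rewrite (cardsD1 w) wW.
  have := disjointFr (half_disjoint wS xw x'w xx) (subsetP Wx h hW).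
  by rewrite (subsetP Wx' h hW).
have w'x : w' \in half w x by apply: (subsetP Wx); rewrite !inE eq_sym ww.
have wx' : w \in half w' x' by apply: (subsetP Wx'); rewrite !inE ww.
have gw : g != w by apply: contraNneq gx' => ->.
have [y yw gy] := half_cover wS gS gw.
have xy : x != y by apply: contraNneq gx => ->.
have w'y : w' \notin half w y by rewrite (half_compl wS xw yw xy) w'x !andbF.
have [z zw' zsub] := far_half wS w'S ww yw w'y.
have wz : w \in half w' z by rewrite (subsetP zsub) ?setU11.
have zx' : z = x'.
  by apply/eqP/idPn => zx'; move: wz; rewrite (half_compl w'S x'w zw') ?wx' ?andbF // eq_sym.
by case/negP: gx'; rewrite -zx' (subsetP zsub) // setU1r.
Qed.

(** Among the halves that contain [P] and belong to edges of [W], a largest one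
    contains the rest of [W]: if it missed [g] in [W], nesting would give a larger
    half, of [g]. *)
Lemma avoid_extreme (P : {set {set V}}) : P \subset S ->
  ~~ (W \subset hull K P) = [exists B in extreme_blocks, [disjoint P & B]].
Proof.
move=> PS; apply/avoidP/exists_inP => [[w [x [wW xw Px]]]|[B]]; last first.
  case/extreme_blocksP=> w [x [wW xw _ ->]]; rewrite -setI_eq0 setIDA setD_eq0.
  by rewrite (setIidPl PS) => Px; exists w, x.
pose ok (p : {set V} * V) := [&& p.1 \in W, p.2 \in p.1 & P \subset half p.1 p.2].
have ok0 : ok (w, x) by rewrite /ok /= wW xw.
case: (arg_maxnP (fun p => #|half p.1 p.2|) ok0) => -[f y] /and3P[/= fW yf Py] maxf.
have fS := subsetP WS f fW.
exists (S :\: half f y); last first.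
  by rewrite -setI_eq0 setIDA setD_eq0 (setIidPl PS).
apply/extreme_blocksP; exists f, y; split=> //; apply/subsetP => g /setD1P[gf gW].
apply/negPn/negP => gy; have gS := subsetP WS g gW.
have [z zg sub] : exists2 z, z \in g & f |: half f y \subset half g z.
  by apply: far_half => //; rewrite eq_sym.
have /maxf : ok (g, z).
  by rewrite /ok /= gW zg (subset_trans Py (subset_trans (subsetUr _ _) sub)).
rewrite /= leqNgt => /negP[]; apply: leq_trans (subset_leq_card sub).
by rewrite cardsU1 edge_notin_half.
Qed.

End Avoidance.

Theorem tree_nim_le3 (W : {set {set V}}) : W != set0 -> W \subset S ->
  nim_DNG S K W <= 3.
Proof.
move=> W0 WS.
have [W2|W1] := ltnP 1 #|W|.
  rewrite (@block_game_start _ _ _ _ S (extreme_blocks W)) ?block_nim_le3 //.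
  - by apply/bigcupsP => B /extreme_blocksP[w [x [_ _ _ ->]]]; apply: subsetDl.
  - exact: trivIset_extreme_blocks.
  - exact: set0_extreme_blocks.
  - by move=> P PS; rewrite avoid_extreme // PS.
  have := avoid_extreme WS (sub0set _); have /set0Pn[w wW] := W0.
  have [u [v [_ wE]]] := edgesP _ (subsetP WS w wW).
  have -> : ~~ (W \subset hull K set0).
    by apply/(avoidP WS); exists w, u; rewrite wE set21 -wE wW sub0set.
  by case/esym/exists_inP => B BC _; apply/set0Pn; exists B.
have /cards1P[w WE] : #|W| == 1 by rewrite eqn_leq W1 card_gt0.
have wS : w \in S by rewrite (subsetP WS) // WE set11.
have [u [v [uv wE]]] := edgesP _ wS.
have [_ _ irr _ _] := treeE.
have uNv : u != v by apply: contraTneq uv => ->; rewrite irr.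
have uw : u \in w by rewrite wE set21.
have vw : v \in w by rewrite wE set22.
have avoidE (P : {set {set V}}) :
    ~~ (W \subset hull K P) = (P \subset half w u) || (P \subset half w v).
  apply/(avoidP WS)/orP => [[w1 [z [/[!WE]/set1P->]]]|].
    by rewrite {1}wE => /set2P[]->; [left | right].
  by case=> Px; [exists w, u | exists w, v]; rewrite WE set11.
have [[x [y [xw yw xNy x0 avoidxy]]]|[u0 v0]] :
    (exists x y, [/\ x \in w, y \in w, x != y, half w x = set0
     & forall P : {set {set V}},
       ~~ (W \subset hull K P) = (P \subset half w x) || (P \subset half w y)])
    \/ half w u != set0 /\ half w v != set0.
  have [u0|u0] := eqVneq (half w u) set0; first by left; exists u, v.
  have [v0|v0] := eqVneq (half w v) set0; last by right.
  by left; exists v, u; split; rewrite 1?eq_sym // => P; rewrite avoidE orbC.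
  have yE : half w y = S :\ w.
    by apply/setP => g; rewrite (half_compl wS xw yw xNy) x0 in_set0 andbT in_setD1 andbC.
  (* If one half is empty, the other is everything but [w]. *)
  rewrite (@block_game_start _ _ _ _ S [set [set w]]) ?block_nim_le3 //.
  - by rewrite cover1 sub1set.
  - exact: trivIset1.
  - by rewrite in_set1 eq_sym -card_gt0 cards1.
  - move=> P PS; rewrite avoidxy x0 yE PS subset0 subsetD1 PS.
    rewrite orb_idl => [|/eqP->]; last by rewrite in_set0.
    rewrite -disjoints1 disjoint_sym; apply/idP/exists_inP => [wP|[_ /set1P->] //].
    by exists [set w]; rewrite ?set11 // disjoint_sym.
  by rewrite -card_gt0 cards1.
have dis := half_disjoint wS uw vw uNv.
have uvNE : half w u != half w v.
  by apply: contraNneq u0 => uvE; move: dis; rewrite -setI_eq0 -uvE setIid.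
(* [w] is never playable, and within the other edges each half is the
   complement of the other one. *)
rewrite (@block_game_start _ _ _ _ (S :\ w) [set half w u; half w v]) ?block_nim_le3 //.
- exact: subsetDl.
- apply/bigcupsP => B /set2P[]->; rewrite subsetD1 half_sub edge_notin_half //.
- apply/trivIsetP => A B /set2P[]-> /set2P[]->; rewrite ?eqxx // 1?disjoint_sym //.
- by rewrite in_set2 negb_or ![set0 == _]eq_sym u0.
- move=> P PS; rewrite avoidE; apply/orP/andP => [Puv|[PD /exists_inP[B]]].
    split.
      case: Puv => /subset_trans; apply; by rewrite subsetD1 half_sub edge_notin_half.
    apply/exists_inP; case: Puv => Px; [exists (half w v)|exists (half w u)];
      rewrite ?set21 ?set22 //; apply: disjointWl Px _ => //; by rewrite disjoint_sym.
  have inPD g : g \in P -> (g \in S) && (g != w).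
    by move/(subsetP PD); rewrite in_setD1 andbC.
  have vNu : v != u by rewrite eq_sym.
  case/set2P=> -> PB; [right|left]; apply/subsetP => g gP.
    by rewrite (half_compl wS uw vw uNv) (disjointFr PB gP) andbT inPD.
  by rewrite (half_compl wS vw uw vNu) (disjointFr PB gP) andbT inPD.
by apply/set0Pn; exists (half w u); rewrite set21.
Qed.

End TreeHalves.

(** * Paths *)

Section PathGraph.

Variable m : nat.

Definition path_adj : rel 'I_m.+1 :=
  [rel u v : 'I_m.+1 | (u.+1 == v :> nat) || (v.+1 == u :> nat)].

Definition path_edge (i : 'I_m) : {set 'I_m.+1} :=
  [set widen_ord (leqnSn m) i; lift ord0 i].

Definition path_segment (a b : nat) : {set {set 'I_m.+1}} :=
  [set path_edge i | i : 'I_m & a <= i < b].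

Let S := edges path_adj.
Let K := edge_convex path_adj.

Lemma path_edgeE (u v : 'I_m.+1) : u.+1 = v ->
  exists2 i : 'I_m, i = u :> nat & [set u; v] = path_edge i.
Proof.
move=> uv; have um : u < m by rewrite -ltnS uv ltn_ord.
exists (Ordinal um) => //; congr [set _; _]; apply: val_inj => //=.
Qed.

Lemma path_edgesP g : reflect (exists i, g = path_edge i) (g \in S).
Proof.
apply: (iffP imsetP) => [[[u v]]|[i ->]].
  rewrite inE /path_adj /= => /orP[]/eqP/path_edgeE[i _ iE] ->; exists i => //.
  by rewrite setUC.
by exists (widen_ord (leqnSn m) i, lift ord0 i) => //; rewrite inE /path_adj /= eqxx.
Qed.

(** An edge is determined by its ends: each of two equal edges contains the lower
    end of the other. *)
Lemma path_edge_inj : injective path_edge.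
Proof.
move=> i j ij.
have ij1 : widen_ord (leqnSn m) i \in path_edge j by rewrite -ij set21.
have ji1 : widen_ord (leqnSn m) j \in path_edge i by rewrite ij set21.
move: ij1 ji1; rewrite !inE -!(inj_eq (@ord_inj _)) /= /bump !leq0n => ij1 ji1.
by apply: ord_inj; lia.
Qed.

Lemma path_segment_sub a b : path_segment a b \subset S.
Proof. by apply/subsetP => _ /imsetP[i _ ->]; apply/path_edgesP; exists i. Qed.

Lemma mem_path_segment a b i : (path_edge i \in path_segment a b) = (a <= i < b).
Proof. by rewrite mem_imset ?inE //; apply: path_edge_inj. Qed.

Lemma path_segment_connect a b v : a <= v <= b -> b <= m ->
  connect [rel u w | [set u; w] \in path_segment a b] (inord a) (inord v).
Proof.
move=> /andP[/subnKC <-]; move: (v - a) => k; elim: k => [|k IHk] kb bm.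
  by rewrite addn0 connect0.
apply: connect_trans (IHk _ bm) (connect1 _); first by lia.
have [|i iE /= ->] := @path_edgeE (inord (a + k)) (inord (a + k.+1)).
  by rewrite !inordK; lia.
by rewrite mem_path_segment iE inordK; lia.
Qed.

Lemma path_segment_convex a b : a <= b <= m -> path_segment a b \in K.
Proof.
move=> abm.
apply: (@rooted_convex _ _ [set v : 'I_m.+1 | a <= v <= b] _ (inord a)).
- exact: path_segment_sub.
- move=> _ /imsetP[i /[!inE] iab ->]; apply/subsetP => v.
  by case/set2P=> ->; rewrite inE /= /bump ?leq0n ?add1n; lia.
by move=> v /[!inE] vab; rewrite -(inord_val v) path_segment_connect //; lia.
Qed.

(** Without the edge [b], the vertices up to [b] could not be left along edges
    of [F]. *)
Lemma path_convex_between F (a b c : 'I_m) : F \in K -> a <= b <= c ->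
  path_edge a \in F -> path_edge c \in F -> path_edge b \in F.
Proof.
rewrite inE => /existsP[U /and3P[FS /forall_inP FU /forall_inP conn]] abc aF cF.
apply/negPn/negP => bF.
have aU := subsetP (FU _ aF) _ (set21 _ _); have cU := subsetP (FU _ cF) _ (set22 _ _).
suff : lift ord0 c <= b by rewrite lift0; lia.
apply: (connectS (A := fun v : 'I_m.+1 => v <= b)) (forall_inP (conn _ aU) _ cU).
  by rewrite /=; lia.
move=> u w /= ub uwF; have /path_edgesP[i uwE] := subsetP FS _ uwF.
have := set21 u w; have := set22 u w; rewrite uwE !inE.
rewrite -!(inj_eq (@ord_inj _)) /= /bump !leq0n !add1n => hw hu.
rewrite leqNgt; apply/negP => bw; case/negP: bF.
suff -> : b = i by rewrite -uwE.
by apply: val_inj => /=; lia.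
Qed.

(** In a cycle, both neighbours of the largest vertex would be its predecessor on
    the path. *)
Lemma path_tree : is_tree path_adj.
Proof.
have sym : symmetric path_adj by move=> u v; rewrite /path_adj /= orbC.
have irr : irreflexive path_adj by move=> u; rewrite /path_adj /=; lia.
split=> //; first by rewrite card_ord.
- have conn0 v : connect path_adj (inord 0) v.
    have : connect [rel u w | [set u; w] \in path_segment 0 m] (inord 0) v.
      by rewrite -(inord_val v) path_segment_connect //; have := ltn_ord v; lia.
    apply: connect_sub => u w /= uw; apply: connect1.
    exact: edge_rel sym irr (subsetP (path_segment_sub 0 m) _ uw).
  by move=> u v; apply: connect_trans (conn0 v); rewrite sym_connect_sym.
move=> c c2 /andP[cyc uniqc].
have [x0 x0c] : exists x, x \in c.
  by case: c c2 {cyc uniqc} => // x c; exists x; rewrite mem_head.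
case: (arg_maxnP (fun v : 'I_m.+1 => v : nat) x0c) => x xc maxx.
have [i c' cE] := rot_to xc.
move: cyc uniqc c2; rewrite -(rot_cycle i) -(rot_uniq i) -(size_rot i) cE.
have {}maxx v : v \in c' -> v <= x.
  move=> vc; have : v \in rot i c by rewrite cE inE vc orbT.
  by rewrite mem_rot => /maxx.
case: c' {cE} maxx => [|y c'] //= maxx; case: (lastP c') maxx => // c'' z maxx.
rewrite rcons_path last_rcons => /andP[xy /andP[_ zx]] /and3P[_ yz _] _.
case/negP: yz; suff -> : y = z by rewrite mem_rcons mem_head.
have := maxx y (mem_head _ _).
have : z <= x by apply: maxx; rewrite inE mem_rcons mem_head orbT.
by move: xy zx; rewrite /path_adj /= => *; apply: val_inj => /=; lia.
Qed.

Lemma card_path_segment a b : a <= b <= m -> #|path_segment a b| = b - a.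
Proof.
move=> abm; rewrite card_imset; last exact: path_edge_inj.
rewrite cardsE -sum1_card.
transitivity (\sum_(a <= i < b) 1); last by rewrite sum_nat_const_nat muln1.
rewrite (big_nat_widenl _ 0) // (big_nat_widen 0 b m); last by lia.
by rewrite big_mkord; apply: eq_bigl.
Qed.

Section EndAvoidance.

Variable j : 'I_m.
Hypothesis j0 : 0 < j.

Let m0 : 0 < m.
Proof. exact: leq_ltn_trans (ltn_ord j). Qed.

Let e0 := path_edge (Ordinal m0).

(** The first edge is a block by itself, since nothing lies behind it; the other
    block consists of the edges from [j] on. *)
Lemma path_end_nim :
  nim_DNG S K [set e0; path_edge j] =
  block_nim (~~ odd (m - j)) (odd (m - j)).+1 m.
Proof.
have jm := ltn_ord j.
pose A := path_segment 0 1; pose B := path_segment j m.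
have cA : #|A| = 1 by rewrite card_path_segment //; lia.
have cB : #|B| = m - j by rewrite card_path_segment //; lia.
have SE : S = path_segment 0 m.
  apply/setP => g; apply/path_edgesP/imsetP => [[i ->]|[i _ ->]]; exists i => //.
  by rewrite inE /=.
have cS : #|S| = m by rewrite SE card_path_segment; lia.
have e0A : e0 \in A by rewrite mem_path_segment.
have jB : path_edge j \in B by rewrite mem_path_segment; lia.
have dAB : [disjoint A & B].
  apply/pred0P => g /=; apply/negP => /andP[/imsetP[i /[!inE] i1 ->]].
  by rewrite mem_path_segment; lia.
have AB : A != B.
  by apply: contraTneq dAB => <-; rewrite -setI_eq0 setIid; apply/set0Pn; exists e0.
rewrite (@block_game_start _ _ _ _ S [set A; B]).
- by rewrite even_blocks2 // odd_blocks2 // cA cB cS.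
- exact: subxx.
- by apply/bigcupsP => C /set2P[]->; apply: path_segment_sub.
- apply/trivIsetP => C D /set2P[]-> /set2P[]->; rewrite ?eqxx // disjoint_sym //.
- rewrite in_set2 negb_or; apply/andP; split; apply/eqP => /setP;
    [move/(_ e0)|move/(_ (path_edge j))]; by rewrite in_set0 ?e0A ?jB.
- move=> P PS; rewrite PS /=; apply/idP/exists_inP => [avoid|[C] /set2P[]-> PC]; last first.
  + apply/subsetPn; exists (path_edge j); rewrite ?set22 //.
    apply/notin_hullP; exists (path_segment 0 j); first by rewrite path_segment_convex //; lia.
    rewrite mem_path_segment ltnn andbT; apply/subsetP => g gP.
    have /path_edgesP[i gE] := subsetP PS g gP.
    by have := disjointFr PC gP; rewrite gE !mem_path_segment; have := ltn_ord i; lia.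
  + apply/subsetPn; exists e0; rewrite ?set21 //.
    apply/notin_hullP; exists (path_segment 1 m); first by rewrite path_segment_convex //; lia.
    rewrite mem_path_segment /= andbT; apply/subsetP => g gP.
    have /path_edgesP[i gE] := subsetP PS g gP.
    by have := disjointFr PC gP; rewrite gE !mem_path_segment; have := ltn_ord i; lia.
  have [PA|/pred0Pn[g /andP[/= gP gA]]] := boolP [disjoint P & A].
    by exists A; rewrite ?set21.
  have [PB|/pred0Pn[h /andP[/= hP hB]]] := boolP [disjoint P & B].
    by exists B; rewrite ?set22.
  case/negP: avoid; have {g gA} gP : e0 \in P.
      case/imsetP: gA gP => i /[!inE] i1 ->; rewrite /e0 (_ : i = Ordinal m0) //.
    by apply: ord_inj => /=; lia.
  case/imsetP: hB hP => i /[!inE] /andP[ji _] -> iP.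
  apply/subsetP => w ww; apply/bigcapP => F /andP[FK /subsetP PF].
  case/set2P: ww => ->; first exact: PF.
  by apply: (path_convex_between (a := Ordinal m0) (c := i) FK); rewrite ?ji ?PF.
by apply/set0Pn; exists A; rewrite set21.
Qed.

Lemma path_end_spectrum :
  tree_DNG_spectrum (block_nim (~~ odd (m - j)) (odd (m - j)).+1 m).
Proof.
exists 'I_m.+1, path_adj, [set e0; path_edge j]; split.
- exact: path_tree.
- by apply/set0Pn; exists e0; rewrite set21.
- by rewrite subUset !sub1set; apply/andP; split; apply/path_edgesP; eexists.
exact: path_end_nim.
Qed.

End EndAvoidance.

End PathGraph.

(** * The spectrum *)

Theorem corollary40 (n : nat) :
  tree_DNG_spectrum n <-> n \in [:: 0; 1; 2; 3].
Proof.
split=> [[V [e [W [treeE W0 WS <-]]]]|].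
  have := tree_nim_le3 treeE W0 WS; rewrite !inE; lia.
rewrite !inE => /or4P[]/eqP->.
- exact: (@path_end_spectrum 3 (@Ordinal 3 2 isT) isT).
- exact: (@path_end_spectrum 2 (@Ordinal 2 1 isT) isT).
- exact: (@path_end_spectrum 3 (@Ordinal 3 1 isT) isT).
exact: (@path_end_spectrum 4 (@Ordinal 4 2 isT) isT).
Qed.
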